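(* For every $\epsilon>0$ there exist a constant $C>0$ and an integer $n_0$ such that for every integer $n\ge n_0$ there exists a $(\pi/2-\epsilon)$AC graph with $n$ vertices and at least $6n-Cn^{2/3}$ edges (i.e., $6n-O(n^{2/3})$ edges).
   Context: A geometric graph is a graph whose vertices are distinct points in $\mathbb{R}^2$ and whose edges are straight-line segments joining their endpoints. Two edges cross if the segments intersect at a point other than a common endpoint; the crossing angle is the smaller angle between the two segments. For $\beta>0$, a geometric graph is a $\beta$ angle crossing ($\beta$AC) graph if every pair of crossing edges crosses at an angle of at least $\beta$. *)

(* Defs.v *)
From HB Require Import structures.
From mathcomp Require Import all_boot all_order all_algebra.
From mathcomp Require Import all_classical all_reals all_analysis.

Set Implicit Arguments.
Unset Strict Implicit.
Unset Printing Implicit Defensive.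

Import Order.TTheory GRing.Theory Num.Theory.

Local Open Scope ring_scope.

Definition dot (R : realType) (a b : R * R) : R := a.1 * b.1 + a.2 * b.2.

(* The Euclidean norm; the library norm on [R * R] is the max norm. *)
Definition enorm (R : realType) (a : R * R) : R := Num.sqrt (dot a a).

Definition vangle (R : realType) (a b : R * R) : R :=
  acos (dot a b / (enorm a * enorm b)).

Definition on_segment (R : realType) (p q z : R * R) : Prop :=
  exists t : R, 0 <= t <= 1 /\
    z = ((1 - t) * p.1 + t * q.1, (1 - t) * p.2 + t * q.2).

(* The smaller of the two angles formed by the lines supporting [pq] and [rs];
   it does not depend on the order of the endpoints of either segment. *)
Definition crossing_angle (R : realType) (p q r s : R * R) : R :=
  Num.min (vangle (q - p) (s - r)) (pi - vangle (q - p) (s - r)).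

Record geometric_graph (R : realType) (T : finType) := GeometricGraph {
  pos : T -> R * R;
  pos_inj : injective pos;
  edges : {set {set T}};
  edges_card2 : forall e : {set T}, e \in edges -> #|e| = 2%N
}.

(* A common point that is an endpoint of only one of the two edges counts as a
   crossing, and so does a collinear overlap (with crossing angle 0). *)
Definition edges_cross (R : realType) (T : finType) (G : geometric_graph R T)
    (u v x y : T) : Prop :=
  exists z : R * R,
    [/\ on_segment (pos G u) (pos G v) z,
        on_segment (pos G x) (pos G y) z &
        ~ exists w : T, w \in [set u; v] :&: [set x; y] /\ z = pos G w].

Definition angle_crossing (R : realType) (T : finType) (beta : R)
    (G : geometric_graph R T) : Prop :=
  forall u v x y : T,
    [set u; v] \in edges G -> [set x; y] \in edges G ->
    [set u; v] != [set x; y] ->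
    edges_cross G u v x y ->
    beta <= crossing_angle (pos G u) (pos G v) (pos G x) (pos G y).

(* Main.v *)
(* Take the vertices in Z^2, n - O(sqrt n) of them filling a square, and join
   two of them when they differ by (1,0), (m,1), (m+1,1) or by the transposes
   (0,1), (1,m), (1,m+1).  The first three vectors have pairwise determinants
   +-1, so they span the edges of a lattice triangulation and do not cross each
   other, and likewise for the last three.  Every crossing is thus between an
   edge of slope at most 1/m and one of slope at least m, hence nearly
   orthogonal for large m.  Inner vertices have degree 12 and the boundary
   costs O(m sqrt n) edges, which is even better than O(n^(2/3)). *)
Require Import Defs.
From HB Require Import structures.
From mathcomp Require Import all_boot all_order all_algebra.
From mathcomp Require Import all_classical all_reals all_analysis.
From mathcomp Require Import zify ring lra.

Set Implicit Arguments.
Unset Strict Implicit.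
Unset Printing Implicit Defensive.

Import Order.TTheory GRing.Theory Num.Theory.

Local Open Scope ring_scope.

(** * Intersections of segments between lattice points *)

Lemma int_itv01 (R : archiRealFieldType) (t : R) :
  t \is a Num.int -> 0 <= t <= 1 -> t = 0 \/ t = 1.
Proof.
move=> /intrP[k ->]; rewrite ler0z -[1]/(1%:~R) ler_int => /andP[k0 k1].
have [->|->] : k = 0 \/ k = 1 by lia.
  by left.
by right.
Qed.

Definition det2 (R : pzRingType) (a b : nat * nat) : R :=
  a.1%:R * b.2%:R - a.2%:R * b.1%:R.

Lemma det2_int (R : archiRealFieldType) (a b : nat * nat) :
  det2 R a b \is a Num.int.
Proof. by rewrite rpredB// rpredM// natr_int. Qed.

Lemma int_mul_unit (R : archiRealFieldType) (t D K : R) :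
  D \is a Num.int -> D ^+ 2 = 1 -> K \is a Num.int -> t * D = K ->
  t \is a Num.int.
Proof.
move=> Dint D2 Kint tD.
have -> : t = K * D by rewrite -tD -mulrA -expr2 D2 mulr1.
by rewrite rpredM.
Qed.

(** Cramer's rule: taking determinants of [p + t d = r + w e] with [e] and with [d] shows that
    [t * det2 R d e] and [w * det2 R d e] are integers. The determinant is a unit, so [t] and [w]
    are integers themselves. *)
Lemma lattice_segments_unimodular (R : archiRealFieldType) (p r d e : nat * nat)
    (t w : R) :
  0 <= t <= 1 -> 0 <= w <= 1 ->
  p.1%:R + t * d.1%:R = r.1%:R + w * e.1%:R ->
  p.2%:R + t * d.2%:R = r.2%:R + w * e.2%:R ->
  det2 R d e ^+ 2 = 1 -> (t = 0 \/ t = 1) /\ (w = 0 \/ w = 1).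
Proof.
move=> t01 w01 E1 E2 D1.
split; apply: int_itv01 => //.
- apply: (int_mul_unit (det2_int _ d e) D1 (K := det2 R r e - det2 R p e)).
    by rewrite rpredB// det2_int.
  rewrite /det2; apply/eqP; rewrite -subr_eq0; apply/eqP.
  transitivity ((p.1%:R + t * d.1%:R - (r.1%:R + w * e.1%:R)) * e.2%:R -
    (p.2%:R + t * d.2%:R - (r.2%:R + w * e.2%:R)) * e.1%:R : R); first by ring.
  by rewrite E1 E2; ring.
- apply: (int_mul_unit (det2_int _ d e) D1 (K := det2 R r d - det2 R p d)).
    by rewrite rpredB// det2_int.
  rewrite /det2; apply/eqP; rewrite -subr_eq0; apply/eqP.
  transitivity ((p.1%:R + t * d.1%:R - (r.1%:R + w * e.1%:R)) * d.2%:R -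
    (p.2%:R + t * d.2%:R - (r.2%:R + w * e.2%:R)) * d.1%:R : R); first by ring.
  by rewrite E1 E2; ring.
Qed.

(** The vector [f] certifies that [d] is primitive: taking determinants with [f] makes [t - w] an
    integer in [-1, 1]. The value 0 means equal starting points; the values 1 and -1 force both
    parameters to be extremal. *)
Lemma lattice_segments_par (R : archiRealFieldType) (p r d f : nat * nat)
    (t w : R) :
  0 <= t <= 1 -> 0 <= w <= 1 ->
  p.1%:R + t * d.1%:R = r.1%:R + w * d.1%:R ->
  p.2%:R + t * d.2%:R = r.2%:R + w * d.2%:R ->
  det2 R d f ^+ 2 = 1 ->
  p = r \/ (t = 0 \/ t = 1) /\ (w = 0 \/ w = 1).
Proof.
move=> t01 w01 E1 E2 D1.
have : t - w \is a Num.int.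
  apply: (int_mul_unit (det2_int _ d f) D1 (K := det2 R r f - det2 R p f)).
    by rewrite rpredB// det2_int.
  rewrite /det2; apply/eqP; rewrite -subr_eq0; apply/eqP.
  transitivity ((p.1%:R + t * d.1%:R - (r.1%:R + w * d.1%:R)) * f.2%:R -
    (p.2%:R + t * d.2%:R - (r.2%:R + w * d.2%:R)) * f.1%:R : R); first by ring.
  by rewrite E1 E2; ring.
move=> /intrP[k tw].
have : - 1%:~R <= k%:~R :> R by rewrite -tw; lra.
have : k%:~R <= 1%:~R :> R by rewrite -tw; lra.
rewrite -mulrNz !ler_int => k1 k2.
have [k0|[k0|k0]] : k = 0 \/ k = 1 \/ k = -1 by lia.
- left.
  have tE : t = w by move: tw; rewrite k0; lra.
  move: E1 E2; rewrite tE => /addIr /mulrIn e1 /addIr /mulrIn e2.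
  case: p r {D1 tw} e1 e2 => [? ?] [? ?] /= e1 e2.
  by rewrite e1 ?e2 // oner_eq0.
- by right; move: tw; rewrite k0; split; [right|left]; lra.
- by right; move: tw; rewrite k0; split; [left|right]; lra.
Qed.

(** * Lower bounds on crossing angles *)

Section Angle.
Variable R : realType.
Implicit Types a b p q r s : R * R.

Lemma dotC a b : dot a b = dot b a.
Proof. by rewrite /dot mulrC [X in _ + X]mulrC. Qed.

Lemma vangleC a b : vangle a b = vangle b a.
Proof. by rewrite /vangle dotC [enorm a * _]mulrC. Qed.

Lemma crossing_angleC p q r s : crossing_angle p q r s = crossing_angle r s p q.
Proof. by rewrite /crossing_angle vangleC. Qed.

Lemma dot_ge0 a : 0 <= dot a a.
Proof. by rewrite /dot -!expr2 addr_ge0 ?sqr_ge0. Qed.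

Lemma enorm_ge1 a : `|a.1| <= enorm a.
Proof.
rewrite -sqrtr_sqr ler_sqrt ?dot_ge0//.
by rewrite /dot -!expr2 lerDl sqr_ge0.
Qed.

Lemma enorm_ge2 a : `|a.2| <= enorm a.
Proof.
rewrite -sqrtr_sqr ler_sqrt ?dot_ge0//.
by rewrite /dot -!expr2 lerDr sqr_ge0.
Qed.

(** [acos] is decreasing and [sin e] is the cosine of [pi / 2 - e]. The second bound is the first
    one at [- x]. *)
Lemma acos_ge_pihalfB (e x : R) : 0 <= e <= pi / 2 -> `|x| <= sin e ->
  pi / 2 - e <= acos x /\ pi / 2 - e <= pi - acos x.
Proof.
move=> e01.
suff H (y : R) : -1 <= y <= 1 -> y <= sin e -> pi / 2 - e <= acos y.
  move=> xe; have xe1 := le_trans xe (sin_le1 _).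
  have x1 : -1 <= x <= 1 by rewrite -ler_norml.
  split; first by rewrite H// (le_trans (ler_norm _)).
  rewrite -acosN// H ?(le_trans _ xe)//; first by move: x1; lra.
  by rewrite -normrN ler_norm.
move=> y1 ye.
have pi0 := pi_ge0 R.
rewrite leNgt -ltr_cos ?acosK ?in_itv/= ?acos_ge0 ?acos_lepi//; last lra.
by rewrite -leNgt cosB cos_pihalf sin_pihalf mul0r add0r mul1r.
Qed.

(** For [a] nearly horizontal and [b] nearly vertical, each product in [dot a b] is at most |a.1|
    |b.2| / m in absolute value, so the cosine is at most 2 / m, hence at most [sin e]. *)
Lemma crossing_angle_ge (e m : R) p q r s :
  0 <= e <= pi / 2 -> 0 < m -> 2 <= m * sin e ->
  (q - p).1 != 0 -> m * `|(q - p).2| <= `|(q - p).1| ->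
  (s - r).2 != 0 -> m * `|(s - r).1| <= `|(s - r).2| ->
  pi / 2 - e <= crossing_angle p q r s.
Proof.
rewrite /crossing_angle; move: (q - p) (s - r) => a b e01 m0 me a0 am b0 bm.
rewrite le_min; apply/andP; apply: acos_ge_pihalfB => //.
have na := enorm_ge1 a; have nb := enorm_ge2 b.
have na0 : 0 < enorm a by rewrite (lt_le_trans _ na)// normr_gt0.
have nb0 : 0 < enorm b by rewrite (lt_le_trans _ nb)// normr_gt0.
rewrite normrM normfV (ger0_norm (ltW (mulr_gt0 na0 nb0))).
rewrite ler_pdivrMr ?mulr_gt0// -(ler_pM2l m0).
have ab : `|a.1| * `|b.2| <= enorm a * enorm b by rewrite ler_pM.
apply: (@le_trans _ _ (2 * (`|a.1| * `|b.2|))).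
  rewrite (le_trans (ler_wpM2l (ltW m0) (ler_normD _ _)))// !normrM mulrDr.
  rewrite mulr2n mulrDl mul1r lerD//.
    by rewrite mulrCA ler_wpM2l.
  by rewrite mulrA ler_wpM2r.
by rewrite [leRHS]mulrA ler_pM// mulr_ge0.
Qed.

End Angle.

(** * Unordered pairs and symmetries of crossing *)

Lemma set2_inj (T : finType) (a b u v : T) :
  [set a; b] = [set u; v] -> (a = u /\ b = v) \/ (a = v /\ b = u).
Proof.
move=> E.
have /set2P[] : a \in [set u; v] by rewrite -E set21.
  move=> au; left; split => //; subst u.
  have /set2P[] // : b \in [set a; v] by rewrite -E set22.
  have /set2P[] // : v \in [set a; b] by rewrite E set22.
  by move=> -> ->.
move=> av; right; split => //; subst v.
have /set2P[] // : b \in [set u; a] by rewrite -E set22.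
have /set2P[] // : u \in [set a; b] by rewrite E set21.
by move=> -> ->.
Qed.

Lemma on_segmentC (R : realType) (p q z : R * R) :
  on_segment p q z -> on_segment q p z.
Proof.
move=> [t [t01 ->]]; exists (1 - t); split; first by move: t01; lra.
by congr pair; ring.
Qed.

Lemma edges_crossCl (R : realType) (T : finType) (G : geometric_graph R T)
  (u v x y : T) : edges_cross G u v x y -> edges_cross G v u x y.
Proof.
move=> [z [? ? ?]]; exists z; rewrite finset.setUC; split => //.
exact: on_segmentC.
Qed.

Lemma edges_crossC (R : realType) (T : finType) (G : geometric_graph R T)
  (u v x y : T) : edges_cross G u v x y -> edges_cross G x y u v.
Proof. by move=> [z [? ? ?]]; exists z; rewrite finset.setIC. Qed.

(** * Graphs on lattice points with prescribed difference vectors *)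

Section LatticeGraph.
Variables (R : realType) (T : finType) (ipos : T -> nat * nat).
Hypothesis ipos_inj : injective ipos.
Variable D : seq (nat * nat).
Hypothesis D0 : (0, 0)%N \notin D.

Definition lattice_pos (v : T) : R * R := ((ipos v).1%:R, (ipos v).2%:R).

Lemma lattice_pos_inj : injective lattice_pos.
Proof.
move=> u v [] /eqP + /eqP; rewrite !eqr_nat => /eqP e1 /eqP e2.
apply: ipos_inj; move: e1 e2.
by case: (ipos u) (ipos v) => [? ?] [? ?] /= -> ->.
Qed.

Definition step (d : nat * nat) (w : T * T) : bool :=
  ipos w.2 == ((ipos w.1).1 + d.1, (ipos w.1).2 + d.2)%N.

Definition arcs : {set T * T} := [set w | has (step^~ w) D].

Definition lattice_edges : {set {set T}} := [set [set w.1; w.2] | w in arcs].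

Lemma lattice_edgeP (u v : T) : [set u; v] \in lattice_edges ->
  exists2 d, d \in D & step d (u, v) \/ step d (v, u).
Proof.
move=> /imsetP[[a b]]; rewrite inE => /hasP[d dD sd] /set2_inj /= uv.
by exists d => //; case: uv => -[-> ->]; [left|right].
Qed.

Lemma lattice_edges_card2 (e : {set T}) : e \in lattice_edges -> #|e| = 2%N.
Proof.
move=> /imsetP[[a b]]; rewrite inE => /hasP[[d1 d2] dD sd] -> /=.
rewrite cards2; case: eqVneq => // ab; move: sd; rewrite /step /= -ab.
case: (ipos a) => x y /= /eqP [] ex ey.
by move: D0; have -> : (0, 0)%N = (d1, d2); [congr pair; lia|rewrite dD].
Qed.

(** Steps have nonnegative coordinates, so if both orientations of an edge were arcs, two steps
    would sum to zero and (0, 0) would lie in [D]. *)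
Lemma card_lattice_edges : #|lattice_edges| = #|arcs|.
Proof.
apply: card_in_imset => -[a b] [u v]; rewrite !inE.
move=> /hasP[[d1 d2] dD sd] /hasP[[e1 e2] eD se] /set2_inj /= [] [? ?]; subst a b => //.
move: sd se; rewrite /step /=; case: (ipos u) (ipos v) => [x y] [x' y'] /=.
move=> /eqP[] ? ? /eqP[] ? ?.
by move: D0; have -> : (0, 0)%N = (d1, d2); [congr pair; lia|rewrite dD].
Qed.

(** Double counting: the positions of the two ends of an arc determine its step. *)
Lemma card_arcs : uniq D -> #|arcs| = (\sum_(d <- D) #|[set w | step d w]|)%N.
Proof.
move=> Du; rewrite -sum1_card big_mkcond /=.
under [RHS]eq_bigr => d _ do rewrite -sum1_card big_mkcond /=.
rewrite exchange_big /=; apply: eq_bigr => -[a b] _.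
under [RHS]eq_bigr => d _ do rewrite inE.
rewrite -big_mkcond sum1_count inE /step /=.
case: (ipos a) (ipos b) => [x y] [x' y'] /=.
have sE d : ((x', y') == (x + d.1, y + d.2)%N) ->
   d = ((x', y').1 - (x, y).1, (x', y').2 - (x, y).2)%N.
  by case: d => d1 d2 /eqP [-> ->] /=; congr pair; lia.
case: hasP => [[d dD sd]|nD].
  rewrite (eq_in_count (a2 := pred1 d)) ?count_uniq_mem ?dD// => c _ /=.
  by apply/idP/eqP => [/sE ->|->//]; rewrite {1}(sE _ sd).
by apply/esym/eqP; rewrite -leqn0 leqNgt -has_count; apply/negP => /hasP.
Qed.

Definition lattice_graph : geometric_graph R T :=
  GeometricGraph lattice_pos_inj lattice_edges_card2.

Lemma lattice_endpoint_common (a b c d : T) (t w : R) (z : R * R) :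
  z = ((1 - t) * (lattice_pos a).1 + t * (lattice_pos b).1,
       (1 - t) * (lattice_pos a).2 + t * (lattice_pos b).2) ->
  z = ((1 - w) * (lattice_pos c).1 + w * (lattice_pos d).1,
       (1 - w) * (lattice_pos c).2 + w * (lattice_pos d).2) ->
  (t = 0 \/ t = 1) /\ (w = 0 \/ w = 1) ->
  exists v : T, v \in [set a; b] :&: [set c; d] /\ z = pos lattice_graph v.
Proof.
have H (s : R) (u v : T) :
  s = 0 \/ s = 1 -> exists2 x, x \in [set u; v] &
   ((1 - s) * (lattice_pos u).1 + s * (lattice_pos v).1,
       (1 - s) * (lattice_pos u).2 + s * (lattice_pos v).2) = lattice_pos x.
  case=> ->; [exists u|exists v]; rewrite ?set21 ?set22//.
    by rewrite subr0 !mul1r !mul0r !addr0 -surjective_pairing.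
  by rewrite subrr !mul1r !mul0r !add0r -surjective_pairing.
move=> zt zw [/(H _ a b) [x xab xE] /(H _ c d) [y ycd yE]].
exists x; split; last by rewrite zt xE.
have xy : x = y by apply: lattice_pos_inj; rewrite -xE -yE -zt.
by rewrite inE xab xy ycd.
Qed.

(** By the two segment lemmas, a common point is a shared endpoint, which is no crossing, unless the
    edges are parallel with the same start and thus equal. *)
Lemma no_cross (d e f : nat * nat) (u v x y : T) :
  step d (u, v) -> step e (x, y) ->
  det2 R d e ^+ 2 = 1 \/ (d = e /\ det2 R d f ^+ 2 = 1) ->
  edges_cross lattice_graph u v x y -> [set u; v] = [set x; y].
Proof.
move=> /eqP /= sd /eqP /= se H [z [[t [t01 zt]] [w [w01 zw]] zN]].
have E1 : (ipos u).1%:R + t * d.1%:R = (ipos x).1%:R + w * e.1%:R.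
  move: zw; rewrite zt /= /lattice_pos sd se /= => -[+ _]; rewrite !natrD.
  by move=> E; apply: etrans (etrans E _); ring.
have E2 : (ipos u).2%:R + t * d.2%:R = (ipos x).2%:R + w * e.2%:R.
  move: zw; rewrite zt /= /lattice_pos sd se /= => -[_]; rewrite !natrD.
  by move=> E; apply: etrans (etrans E _); ring.
case: H => [D1|[de D1]].
  by case: zN; apply: lattice_endpoint_common zt zw _; exact: lattice_segments_unimodular E1 E2 D1.
subst e; have [ux|tw] := lattice_segments_par t01 w01 E1 E2 D1.
  by congr [set _; _]; apply: ipos_inj; rewrite // sd se ux.
by case: zN; exact: lattice_endpoint_common zt zw _.
Qed.

End LatticeGraph.

(** * The nearly horizontal and nearly vertical steps *)

Definition hsteps (m : nat) : seq (nat * nat) :=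
  [:: (1, 0); (m, 1); (m.+1, 1)]%N.

Definition vsteps (m : nat) : seq (nat * nat) :=
  [:: (0, 1); (1, m); (1, m.+1)]%N.

Lemma hsteps_unimodular (R : realType) (m : nat) (d e : nat * nat) :
  d \in hsteps m -> e \in hsteps m ->
  exists f, det2 R d e ^+ 2 = 1 \/ (d = e /\ det2 R d f ^+ 2 = 1).
Proof.
rewrite !inE => /or3P[] /eqP-> /or3P[] /eqP->;
  (* Distinct steps, with a placeholder for [f]; the cases left over are equal steps, each completed
     by [f] to a basis of the lattice. *)
  try (by exists (0, 0)%N; left; rewrite /det2 /= -?natr1; ring).
- by exists (0, 1)%N; right; rewrite /det2 /=; split => //; ring.
- by exists (1, 0)%N; right; rewrite /det2 /=; split => //; ring.
- by exists (1, 0)%N; right; rewrite /det2 /=; split => //; ring.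
Qed.

Lemma vsteps_unimodular (R : realType) (m : nat) (d e : nat * nat) :
  d \in vsteps m -> e \in vsteps m ->
  exists f, det2 R d e ^+ 2 = 1 \/ (d = e /\ det2 R d f ^+ 2 = 1).
Proof.
rewrite !inE => /or3P[] /eqP-> /or3P[] /eqP->;
  try (by exists (0, 0)%N; left; rewrite /det2 /= -?natr1; ring).
- by exists (1, 0)%N; right; rewrite /det2 /=; split => //; ring.
- by exists (0, 1)%N; right; rewrite /det2 /=; split => //; ring.
- by exists (0, 1)%N; right; rewrite /det2 /=; split => //; ring.
Qed.

Lemma hsteps_slope (m : nat) (d : nat * nat) :
  d \in hsteps m.+1 -> (0 < d.1)%N /\ (m.+1 * d.2 <= d.1)%N.
Proof. by rewrite !inE => /or3P[] /eqP-> /=; lia. Qed.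

Lemma vsteps_slope (m : nat) (d : nat * nat) :
  d \in vsteps m.+1 -> (0 < d.2)%N /\ (m.+1 * d.1 <= d.2)%N.
Proof. by rewrite !inE => /or3P[] /eqP-> /=; lia. Qed.

(** The parameter starts at 2: for 1 the step (1, 1) would be in both lists, and for 0 the lists
    would have the same elements. *)
Lemma steps_uniq (m : nat) : uniq (hsteps m.+2 ++ vsteps m.+2).
Proof. by rewrite /= !inE /= !xpair_eqE /=; lia. Qed.

Lemma steps_neq0 (m : nat) : (0, 0)%N \notin hsteps m.+2 ++ vsteps m.+2.
Proof. by []. Qed.

Lemma step_dist (R : realType) (T : finType) (ipos : T -> nat * nat)
    (d : nat * nat) (u v : T) :
  step ipos d (u, v) \/ step ipos d (v, u) ->
  `|(lattice_pos R ipos v - lattice_pos R ipos u).1| = d.1%:R /\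
  `|(lattice_pos R ipos v - lattice_pos R ipos u).2| = d.2%:R.
Proof.
rewrite /step /lattice_pos /= => -[] /eqP-> /=; rewrite !natrD.
  by rewrite !(addrC _ d.1%:R) !(addrC _ d.2%:R) !addrK !ger0_norm.
by rewrite !opprD !addNKr ?addrA ?subrr ?sub0r !normrN !ger0_norm.
Qed.

(** * Counting the edges of the square grid *)

Section Grid.
Variables s k : nat.

Let V : finType := ('I_s * 'I_s + 'I_k)%type.

(* The [k] surplus vertices are placed on the x-axis, outside the [s * s]
   square. *)
Definition grid_pos (v : V) : nat * nat :=
  match v with
  | inl xy => (xy.1 : nat, xy.2 : nat)
  | inr i => (s + i, 0)%N
  end.

Lemma grid_pos_inj : injective grid_pos.
Proof.
move=> [[x y]|i] [[x' y']|i'] /= [].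
- by move=> /val_inj-> /val_inj->.
- by have := ltn_ord x; lia.
- by have := ltn_ord x'; lia.
- by move=> /addnI/val_inj->.
Qed.

Lemma ltn_ord_shift (a : nat) (x : 'I_(s - a)) : (x + a < s)%N.
Proof. by have := ltn_ord x; lia. Qed.

(** Translation by [d] keeps the lower left (s - d.1) by (s - d.2) rectangle inside the square;
    truncated subtraction gives 0 when [d] is too long. *)
Lemma card_grid_step (d : nat * nat) :
  ((s - d.1) * (s - d.2) <= #|[set w | step grid_pos d w]|)%N.
Proof.
pose f (p : 'I_(s - d.1) * 'I_(s - d.2)) : V * V :=
  (inl (widen_ord (leq_subr d.1 s) p.1, widen_ord (leq_subr d.2 s) p.2),
   inl (Ordinal (ltn_ord_shift p.1), Ordinal (ltn_ord_shift p.2))).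
have f_inj : injective f.
  by move=> [x y] [x' y'] [] /= /val_inj-> /val_inj->.
rewrite -[(s - d.1)%N]card_ord -[(s - d.2)%N]card_ord -card_prod.
rewrite -(finset.card_imset predT f_inj); apply/subset_leq_card/fintype.subsetP => w.
by move=> /imsetP[p _ ->]; rewrite inE /step.
Qed.

(** Each step [d] loses at most (d.1 + d.2) s arcs at the boundary, and the coordinates of the six
    steps add up to [4 * m.+2 + 8]. *)
Lemma card_grid_arcs (m : nat) :
  (6 * (s * s) <=
   #|arcs grid_pos (hsteps m.+2 ++ vsteps m.+2)| + (4 * m.+2 + 8) * s)%N.
Proof.
have cd d : (s * s <= #|[set w | step grid_pos d w]| + (d.1 + d.2) * s)%N.
  by apply: leq_trans (leq_add (card_grid_step d) (leqnn _)); nia.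
rewrite card_arcs ?steps_uniq// /hsteps /vsteps /= !big_cons big_nil.
have := (cd (1, 0), cd (m.+2, 1), cd (m.+3, 1),
         cd (0, 1), cd (1, m.+2), cd (1, m.+3))%N.
move: (#|_|) (#|_|) (#|_|) (#|_|) (#|_|) (#|_|) => a1 a2 a3 a4 a5 a6 /=.
by move: (s * s)%N => ss [[[[[]]]]]; nia.
Qed.

End Grid.

(** * Crossing angles in the lattice graph, for any placement at distinct lattice points *)

Lemma lattice_graph_angle_crossing (R : realType) (T : finType)
    (ipos : T -> nat * nat) (ipos_inj : injective ipos) (m : nat) (e : R) :
  0 <= e <= pi / 2 -> 2 <= m.+2%:R * sin e ->
  angle_crossing (pi / 2 - e)
    (lattice_graph R ipos_inj (steps_neq0 m)).
Proof.
move=> e01 me u v x y uvE xyE uvxy cross.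
(* Edges from the same family do not cross; the four cases are the orientations of the two edges. *)
have nc (D : seq (nat * nat)) (d d' : nat * nat) :
    (forall d d', d \in D -> d' \in D ->
      exists f, det2 R d d' ^+ 2 = 1 \/ (d = d' /\ det2 R d f ^+ 2 = 1)) ->
    d \in D -> d' \in D ->
    step ipos d (u, v) \/ step ipos d (v, u) ->
    step ipos d' (x, y) \/ step ipos d' (y, x) -> False.
  move=> DD dD d'D; have [f Df] := DD d d' dD d'D.
  move=> sd sd'; case/eqP: uvxy; case: sd; case: sd' => sd' sd.
  - exact: no_cross sd sd' Df cross.
  - rewrite [RHS]finset.setUC.
    exact: no_cross sd sd' Df (edges_crossC (edges_crossCl (edges_crossC cross))).
  - rewrite [LHS]finset.setUC.
    exact: no_cross sd sd' Df (edges_crossCl cross).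
  - rewrite [LHS]finset.setUC [RHS]finset.setUC; move: cross.
    move=> /edges_crossC/edges_crossCl/edges_crossC/edges_crossCl.
    exact: no_cross sd sd' Df.
have angle (d d' : nat * nat) (a b a' b' : T) :
    d \in hsteps m.+2 -> d' \in vsteps m.+2 ->
    step ipos d (a, b) \/ step ipos d (b, a) ->
    step ipos d' (a', b') \/ step ipos d' (b', a') ->
    pi / 2 - e <= crossing_angle (lattice_pos R ipos a) (lattice_pos R ipos b)
      (lattice_pos R ipos a') (lattice_pos R ipos b').
  move=> /hsteps_slope[d0 dm] /vsteps_slope[d'0 d'm].
  move=> /(step_dist R)[E1 E2] /(step_dist R)[E1' E2'].
  apply: (crossing_angle_ge e01 _ me).
  - by rewrite ltr0n.
  - by rewrite -normr_eq0 E1 pnatr_eq0 -lt0n.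
  - by rewrite E1 E2 -natrM ler_nat.
  - by rewrite -normr_eq0 E2' pnatr_eq0 -lt0n.
  - by rewrite E1' E2' -natrM ler_nat.
have [d + sd] := lattice_edgeP uvE; have [d' + sd'] := lattice_edgeP xyE.
rewrite !mem_cat => /orP[d'h|d'v] /orP[dh|dv].
- by case: (nc _ _ _ (@hsteps_unimodular R m.+2) dh d'h sd sd').
- by rewrite crossing_angleC; exact: angle d'h dv sd' sd.
- exact: angle dh d'v sd sd'.
- by case: (nc _ _ _ (@vsteps_unimodular R m.+2) dv d'v sd sd').
Qed.

(** * Choice of the parameters and the final count *)

Lemma exists_sqrtn (n : nat) : exists s : nat, (s * s <= n <= s * s + 2 * s)%N.
Proof.
elim: n => [|n [s /andP[sn ns]]]; first by exists 0%N.
have [ns'|ns'] := ltnP n (s * s + 2 * s); first by exists s; lia.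
by exists s.+1; nia.
Qed.

Theorem theorem2 (R : realType) (eps : R) (heps : 0 < eps) :
  exists (C : R) (n0 : nat), 0 < C /\
    forall n : nat, (n0 <= n)%N ->
      exists (T : finType) (G : geometric_graph R T),
        [/\ #|T| = n,
            angle_crossing (pi / 2 - eps) G &
            6 * n%:R - C * (n%:R `^ (2 / 3)) <= #|edges G|%:R].
Proof.
have pi0 := pi_gt0 R.
(* The angle bound requires an angle of at most [pi / 2]; shrinking [eps] only strengthens the
   claim. *)
pose e := Num.min eps (pi / 2).
have e0 : 0 < e by rewrite lt_min heps; lra.
have e2 : e <= pi / 2 by rewrite ge_min lexx orbT.
have ee : e <= eps by rewrite ge_min lexx.
have se : 0 < sin e by apply: sin_gt0_pi; lra.
pose m := Num.bound (2 / sin e).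
have me : 2 <= m.+2%:R * sin e.
  rewrite -ler_pdivrMr//; apply: le_trans (_ : m%:R <= _); last by rewrite ler_nat; lia.
  by apply/ltW/archi_boundP; rewrite divr_ge0// ltW.
(* The boundary costs [4 * m.+2 + 8] times s, and the at most 2 s surplus vertices cost another 12
   s. From n = 1 on, n^(1/2) is at most n^(2/3). *)
exists (4 * m.+2 + 20)%:R, 1%N; split; first by rewrite ltr0n addn_gt0 orbT.
move=> n n1; have [s /andP[sn ns]] := exists_sqrtn n.
exists ('I_s * 'I_s + 'I_(n - s * s))%type.
exists (lattice_graph R (@grid_pos_inj s (n - s * s)) (steps_neq0 m)); split.
- by rewrite card_sum card_prod !card_ord subnKC.
- move=> u v x y uv xy uvxy cross.
  apply: le_trans (_ : pi / 2 - e <= _); first by lra.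
  have e01 : 0 <= e <= pi / 2 by lra.
  exact: lattice_graph_angle_crossing e01 me _ _ _ _ uv xy uvxy cross.
rewrite [edges _]/= card_lattice_edges ?steps_neq0//.
have sqrt_le : s%:R <= n%:R `^ (2 / 3) :> R.
  have n1R : 1 <= n%:R :> R by rewrite ler1n.
  apply: (@le_trans _ _ (n%:R `^ 2^-1)); last by apply: ler_powR => //; lra.
  rewrite powR12_sqrt// -(ger0_norm (ler0n R s)) -sqrtr_sqr ler_sqrt//.
  by rewrite -natrX ler_nat -mulnn.
have arcs_ge := card_grid_arcs s (n - s * s) m.
move: #|_| arcs_ge => A arcs_ge.
have : (6 * n <= A + (4 * m.+2 + 20) * s)%N by nia.
rewrite -(ler_nat R) natrD !natrM => H.
rewrite lerBlDr (le_trans H)// lerD2l ler_wpM2l//.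
Qed.
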